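(* The distribution of the family $(L_r)_{r\geq1}$ is characterized by the fact that, for all $p\geq1$ and all vectors $r=(r_1,\ldots,r_p)$ of positive integers, its mixed moments are given by $$\psi(L_{r_1}L_{r_2}\cdots L_{r_p})=\#\,\Pi_2(r),$$ and its classical cumulants are given by $$k_p(L_{r_1},L_{r_2},\ldots,L_{r_p})=\#\,\Pi_2^*(r).$$
   Context: The family $(L_r)_{r\geq1}$: let $\mathcal{G}$ be the group of finite sets of nonnegative integers with the symmetric difference operation, and $\mathbb{C}[\mathcal{G}]$ its group algebra with canonical trace $\sum_A x_A A\mapsto x_\emptyset$. For $r,n\geq1$ let $L_r(n,1)=n^{-r/2}\sum\{a_1,\ldots,a_r\}$, the sum running over all $r$-tuples of pairwise distinct integers of $[1,n]$. Then $(L_r)_{r\geq1}$ is a commutative family whose joint distribution (the map $P\mapsto\psi(P((L_r)_r))$ on polynomials, $\psi$ also denoting the expectation of the limit space) is the pointwise limit, as $n\to\infty$, of that of $(L_r(n,1))_{r\geq1}$. Equivalently, $L_1$ is a standard Gaussian random variable and $L_r=H_r(L_1)$, where $H_r$ are the Hermite polynomials: $H_0=1$, $H_1(x)=x$, $H_1H_r=H_{r+1}+rH_{r-1}$ for $r\geq1$. $k_p$ denotes the classical joint cumulants, as defined by the usual moment–cumulant formula over all partitions. Combinatorial sets: for $r=(r_1,\ldots,r_p)$ a vector of positive integers, $|r|=r_1+\cdots+r_p$, and $f_r:\{1,\ldots,|r|\}\to\{1,\ldots,p\}$ is given by $f_r(x)=k$ if and only if $r_1+\cdots+r_{k-1}<x\leq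 r_1+\cdots+r_k$. Let $\hat 1_r$ be the partition of $\{1,\ldots,|r|\}$ with blocks $f_r^{-1}(1),\ldots,f_r^{-1}(p)$, $\hat 0_{|r|}$ the partition into singletons, and $\hat 1_{|r|}$ the one-block partition. $\Pi_2(r)$ is the set of (possibly crossing) pairings $\pi$ of $\{1,\ldots,|r|\}$ with $\pi\wedge\hat 1_r=\hat 0_{|r|}$, i.e. which do not link two elements having the same image by $f_r$. $\Pi_2^*(r)=\{\pi\in\Pi_2(r):\pi\vee\hat 1_r=\hat 1_{|r|}\}$. Here $\wedge,\vee$ are the meet and join in the lattice of partitions, and $\#$ denotes cardinality. *)

(* Defs.v *)
(* multinomials is imported without its notations, which clash with those of
   MathComp-Analysis. *)
From HB Require Import structures.
From mathcomp Require Import all_boot all_order all_algebra finmap.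
From mathcomp Require Import -(notations) monalg.
From mathcomp Require Import -(notations) mpoly.

Set Implicit Arguments.
Unset Strict Implicit.
Unset Printing Implicit Defensive.

Import Order.TTheory GRing.Theory Num.Theory.

Local Open Scope fset_scope.
Local Open Scope ring_scope.

Definition finsets := {fset nat}.
HB.instance Definition _ := Choice.on finsets.

Section SymmetricDifference.
Implicit Types A B : finsets.

Definition symdiff A B : finsets := (A `\` B) `|` (B `\` A).

Lemma in_symdiff A B x : (x \in symdiff A B) = (x \in A) (+) (x \in B).
Proof. by rewrite !inE; case: (x \in A); case: (x \in B). Qed.

Fact symdiffA : associative symdiff.
Proof. by move=> A B D; apply/fsetP => x; rewrite !in_symdiff addbA. Qed.

Fact symdiffC : commutative symdiff.
Proof. by move=> A B; apply/fsetP => x; rewrite !in_symdiff addbC. Qed.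

Fact symdiff0 : left_id fset0 symdiff.
Proof. by move=> A; apply/fsetP => x; rewrite in_symdiff in_fset0. Qed.

Fact symdiffN : left_inverse fset0 id symdiff.
Proof. by move=> A; apply/fsetP => x; rewrite in_symdiff addbb in_fset0. Qed.

(* The group law is written additively, with neutral element fset0; every
   element is its own opposite. *)
HB.instance Definition _ :=
  GRing.isZmodule.Build finsets symdiffA symdiffC symdiff0 symdiffN.

End SymmetricDifference.

(* Group algebra of an abelian group.  The library only puts a product on
   malg K C for monoids K without nontrivial units, hence the alias. *)
Definition galg (C : comNzRingType) (G : zmodType) := monalg.malg G C.

Section GroupAlgebra.
Variables (C : comNzRingType) (G : zmodType).

HB.instance Definition _ :=
  GRing.Lmodule.copy (galg C G) (monalg.malg G C).

Implicit Types (f g h : galg C G) (a b : G).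

Definition gelt a : galg C G := monalg.mkmalgU a 1.
Definition gcoef a f : C := monalg.mcoeff a f.

Definition gmul f g : galg C G :=
  \sum_(a <- monalg.msupp f) \sum_(b <- monalg.msupp g)
    (gcoef a f * gcoef b g) *: gelt (a + b).

Lemma gcoefD a f g : gcoef a (f + g) = gcoef a f + gcoef a g.
Proof. exact: monalg.mcoeffD. Qed.

Lemma gcoefZ a c f : gcoef a (c *: f) = c * gcoef a f.
Proof. exact: monalg.mcoeffZ. Qed.

Fact gcoef_is_linear a : linear_for *%R (gcoef a).
Proof.
by move=> c f g; rewrite gcoefD gcoefZ.
Qed.
HB.instance Definition _ a :=
  GRing.isLinear.Build C (galg C G) C *%R (gcoef a) (gcoef_is_linear a).

(* The canonical trace. *)
Definition gtrace : {scalar galg C G} := gcoef 0.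

Lemma gcoefP f g : (forall a, gcoef a f = gcoef a g) -> f = g.
Proof. by move=> fg; apply/monalg.malgP. Qed.

Lemma gcoef_gelt a b : gcoef b (gelt a) = (a == b)%:R.
Proof. by rewrite /gcoef /gelt monalg.mcoeffU. Qed.

Lemma gmul_suppw (D E : {fset G}) f g :
  monalg.msupp f `<=` D -> monalg.msupp g `<=` E ->
  gmul f g = \sum_(a <- D) \sum_(b <- E)
               (gcoef a f * gcoef b g) *: gelt (a + b).
Proof.
move=> leD leE; rewrite /gmul (big_fset_incl _ leD) /=; last first.
  move=> a _ /monalg.mcoeff_outdom fa.
  by rewrite big1 // => b _; rewrite /gcoef fa mul0r scale0r.
apply: eq_bigr => a _; apply: big_fset_incl => // b _ /monalg.mcoeff_outdom gb.
by rewrite /gcoef gb mulr0 scale0r.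
Qed.

Fact gmulC : commutative gmul.
Proof.
move=> f g; rewrite /gmul exchange_big /=.
by apply: eq_bigr => a _; apply: eq_bigr => b _; rewrite mulrC addrC.
Qed.

Fact gmulDl : left_distributive gmul +%R.
Proof.
move=> f g h.
pose D := monalg.msupp f `|` monalg.msupp g `|` monalg.msupp (f + g).
have leD k : monalg.msupp k `<=` D -> gmul k h =
    \sum_(a <- D) \sum_(b <- monalg.msupp h)
      (gcoef a k * gcoef b h) *: gelt (a + b) by move=> kD; exact: gmul_suppw.
rewrite !leD; try by apply/fsubsetP => x xk; rewrite /D !in_fsetU xk ?orbT.
rewrite -big_split /=; apply: eq_bigr => a _.
rewrite -big_split /=; apply: eq_bigr => b _.
by rewrite gcoefD mulrDl scalerDl.
Qed.

Fact gmulZl c f g : c *: gmul f g = gmul (c *: f) g.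
Proof.
rewrite (@gmul_suppw (monalg.msupp f) (monalg.msupp g) (c *: f)) //; last first.
  exact: monalg.msuppZ_le.
rewrite scaler_sumr; apply: eq_bigr => a _.
rewrite scaler_sumr; apply: eq_bigr => b _.
by rewrite gcoefZ scalerA mulrA.
Qed.

Fact gmul_geltE a b : gmul (gelt a) (gelt b) = gelt (a + b).
Proof.
rewrite (@gmul_suppw [fset a] [fset b]) ?monalg.msuppU_le //.
by rewrite !big_seq_fset1 !gcoef_gelt !eqxx mulr1 scale1r.
Qed.

Lemma galgE f : f = \sum_(a <- monalg.msupp f) gcoef a f *: gelt a.
Proof.
rewrite {1}[f]monalg.monalgE; apply: eq_bigr => a _; apply: gcoefP => b.
by rewrite gcoefZ gcoef_gelt /gcoef monalg.mcoeffU mulr_natr.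
Qed.

Fact gmul_suml (I : Type) (s : seq I) (F : I -> galg C G) g :
  gmul (\sum_(i <- s) F i) g = \sum_(i <- s) gmul (F i) g.
Proof.
elim: s => [|i s IH]; last by rewrite !big_cons gmulDl IH.
by rewrite !big_nil /gmul monalg.msupp0 big_seq_fset0.
Qed.

Fact gmul_ind (P : galg C G -> Prop) :
  (forall a, P (gelt a)) -> (forall c f, P f -> P (c *: f)) ->
  (forall f g, P f -> P g -> P (f + g)) -> P 0 -> forall f, P f.
Proof.
move=> Pe PZ PD P0 f; rewrite [f]galgE.
by apply: (big_ind P) => // a _; apply/PZ/Pe.
Qed.

Fact gmulA : associative gmul.
Proof.
have m0 g : gmul 0 g = 0 by rewrite /gmul monalg.msupp0 big_seq_fset0.
have Zr c f g : gmul f (c *: g) = c *: gmul f g.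
  by rewrite gmulC -gmulZl gmulC.
have Dr f g h : gmul f (g + h) = gmul f g + gmul f h.
  by rewrite gmulC gmulDl ![gmul _ f]gmulC.
have r0 f : gmul f 0 = 0 by rewrite gmulC m0.
move=> f g h; elim/gmul_ind: f => [a|c f IH|f1 f2 IH1 IH2|].
- elim/gmul_ind: g => [b|c f IH|f1 f2 IH1 IH2|].
  + elim/gmul_ind: h => [d|c f IH|f1 f2 IH1 IH2|].
    * by rewrite !gmul_geltE addrA.
    * by rewrite !Zr IH.
    * by rewrite !Dr IH1 IH2.
    * by rewrite !r0.
  + by rewrite -gmulZl !Zr -gmulZl IH.
  + by rewrite gmulDl !Dr gmulDl IH1 IH2.
  + by rewrite m0 !r0 m0.
- by rewrite -!gmulZl IH.
- by rewrite !gmulDl IH1 IH2.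
- by rewrite !m0.
Qed.

Fact gmul1 : left_id (gelt 0) gmul.
Proof.
move=> f; elim/gmul_ind: f => [a|c f IH|f1 f2 IH1 IH2|].
- by rewrite gmul_geltE add0r.
- by rewrite gmulC -gmulZl gmulC IH.
- by rewrite gmulC gmulDl ![gmul _ (gelt 0)]gmulC IH1 IH2.
- by rewrite gmulC /gmul monalg.msupp0 big_seq_fset0.
Qed.

Fact gelt0_neq0 : gelt 0 != 0.
Proof.
apply/eqP => /(congr1 (gcoef 0)) /eqP.
by rewrite gcoef_gelt eqxx raddf0 oner_eq0.
Qed.

HB.instance Definition _ := GRing.Zmodule_isComNzRing.Build (galg C G)
  gmulA gmulC gmul1 gmulDl gelt0_neq0.
HB.instance Definition _ :=
  GRing.Lmodule_isLalgebra.Build C (galg C G) gmulZl.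
HB.instance Definition _ := GRing.Lalgebra_isComAlgebra.Build C (galg C G).

End GroupAlgebra.

Arguments gelt {C G} a.
Arguments gtrace {C G}.

Section Law.
Variables (C : comNzRingType) (A : comAlgType C).
Implicit Types (psi : A -> C) (L : nat -> A) (s : seq A).

(* Joint distribution of (L_r)_{r >= 1}: a polynomial in the X_r (r >= 1)
   involves only X_1, ..., X_N for some N, and its indeterminate of index
   i : 'I_N stands for X_{i+1}; L 0 plays no role. *)
Definition law psi L (N : nat) (P : mpoly.mpoly N C) : C :=
  psi (mpoly.mmap (in_alg A) (fun i : 'I_N => L i.+1) P).

Definition subfamily (s : seq A) (B : {set 'I_(size s)}) : seq A :=
  [seq tnth (in_tuple s) i | i <- enum B].

(* Classical cumulants, by solving the moment-cumulant formula
   (moment_cumulant below) for the term of the one-block partition; the first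
   argument bounds the depth of the recursion. *)
Fixpoint cumulant_rec (d : nat) psi (s : seq A) : C :=
  if d is d'.+1 then
    psi (\prod_(a <- s) a)
      - \sum_(pi : {set {set 'I_(size s)}} |
                partition pi [set: 'I_(size s)] && (pi != [set setT]))
          \prod_(B in pi) cumulant_rec d' psi (subfamily B)
  else 0.

Definition cumulant psi (s : seq A) : C := cumulant_rec (size s) psi s.

Lemma size_subfamily s (B : {set 'I_(size s)}) : size (subfamily B) = #|B|.
Proof. by rewrite size_map -cardE. Qed.

Lemma proper_block s (pi : {set {set 'I_(size s)}}) (B : {set 'I_(size s)}) :
  partition pi [set: 'I_(size s)] -> pi != [set setT] -> B \in pi ->
  (0 < #|B| < size s)%N.
Proof.
move=> ppi pi1 Bpi; have [_ tpi /negP pi0] := and3P ppi.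
apply/andP; split.
  by rewrite card_gt0; apply/eqP => B0; apply: pi0; rewrite -B0.
have : (#|B| < #|[set: 'I_(size s)]|)%N; last by rewrite cardsT card_ord.
apply: proper_card; rewrite properT; apply: contra pi1 => /eqP BT.
rewrite BT in Bpi; apply/eqP/setP => D; rewrite in_set1.
apply/idP/eqP => [Dpi|->//].
have [x xD] : exists x, x \in D.
  by apply/set0Pn/eqP => D0; apply: pi0; rewrite -D0.
by rewrite -(def_pblock tpi Dpi xD) (def_pblock tpi Bpi) // in_setT.
Qed.

Lemma cumulant_rec_size d psi s :
  (0 < size s <= d)%N -> cumulant_rec d psi s = cumulant psi s.
Proof.
rewrite /cumulant; elim/ltn_ind: d s => d IH s /andP[s0].
case: d IH => [|d] IH; first by case: (size s) s0.
case E: (size s) s0 => [//|m] _; rewrite ltnS => md /=.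
congr (_ - _); apply: eq_bigr => pi /andP[ppi pi1]; apply: eq_bigr => B Bpi.
have := proper_block ppi pi1 Bpi; rewrite -size_subfamily E ltnS.
move=> /andP[B0 Bm].
by rewrite IH ?B0 ?(leq_trans Bm) // IH ?B0 // ltnS.
Qed.

Lemma moment_cumulant psi s : (0 < size s)%N ->
  psi (\prod_(a <- s) a) =
    \sum_(pi : {set {set 'I_(size s)}} | partition pi [set: 'I_(size s)])
      \prod_(B in pi) cumulant psi (subfamily B).
Proof.
move=> s0; have pT : partition [set setT] [set: 'I_(size s)].
  apply/and3P; split; rewrite ?cover1 ?trivIset1 //.
  by rewrite in_set1 eq_sym; apply/set0Pn; exists (Ordinal s0).
rewrite (bigD1 [set setT]) //= big_set1.
have -> : subfamily [set: 'I_(size s)] = s.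
  by rewrite /subfamily enum_setT -enumT (map_tnth_enum (in_tuple s)).
rewrite -(@cumulant_rec_size (size s).+1) ?s0 ?leqW //=.
rewrite -addrA [X in _ + X](_ : _ = 0) ?addr0 //.
rewrite addrC; apply/eqP; rewrite subr_eq0; apply/eqP.
apply: eq_bigr => pi /andP[ppi pi1]; apply: eq_bigr => B Bpi.
have /andP[B0 Bs] := proper_block ppi pi1 Bpi.
by rewrite cumulant_rec_size // size_subfamily B0 ltnW.
Qed.

End Law.

Section Pairings.

Section Partitions.
Variable T : finType.
Implicit Types P Q : {set {set T}}.

Definition part_meet P Q : {set {set T}} :=
  [set B :&: D | B in P, D in Q] :\ set0.

Definition part_join P Q : {set {set T}} :=
  equivalence_partition
    (connect [rel x y | (y \in pblock P x) || (y \in pblock Q x)]) [set: T].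

Definition singletons : {set {set T}} := [set [set x] | x in T].

End Partitions.

Implicit Types r : seq nat.

(* With 0-based positions and blocks, this is f_r; see f_vecP. *)
Definition f_vec r (x : 'I_(sumn r)) : nat := reshape_index r x.

Lemma f_vecP r (x : 'I_(sumn r)) k :
  (f_vec x == k) = (sumn (take k r) <= x < sumn (take k.+1 r))%N.
Proof.
case: x => x /=; rewrite /f_vec /= /reshape_index.
elim: r x k => [//|n r IH] x k /= xr; rewrite subn_eq0.
case: ltnP => [xn|nx].
  by case: k => [|k] /=; rewrite ?take0 ?addn0 ?xn // [RHS]andbC
    [RHS]andbC leqNgt ltn_addr.
rewrite subSn //; case: k => [|k] /=; first by rewrite take0 addn0 ltnNge nx.
by rewrite eqSS IH ?ltn_subLR // leq_subRL // leq_subLR.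
Qed.

Definition vec_part r : {set {set 'I_(sumn r)}} :=
  preim_partition (@f_vec r) [set: 'I_(sumn r)].

Definition Pi2 r : {set {set {set 'I_(sumn r)}}} :=
  [set pi | [&& partition pi [set: 'I_(sumn r)],
                [forall B in pi, #|B| == 2%N] &
                part_meet pi (vec_part r) == singletons _]].

Definition Pi2star r : {set {set {set 'I_(sumn r)}}} :=
  [set pi in Pi2 r |
    part_join pi (vec_part r) == [set [set: 'I_(sumn r)]]].

End Pairings.

(* The set of entries of a tuple of elements of {1, ..., n}; 'I_n is 0-based. *)
Definition tuple_set (n r : nat) (a : r.-tuple 'I_n) : finsets :=
  [fset (tnth a k).+1 | k : 'I_r].

From mathcomp Require Import complex.
From mathcomp Require Import boolp classical_sets reals topology normedtype.
From mathcomp Require Import sequences exp.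
Import numFieldNormedType.Exports.

Local Open Scope complex_scope.
Local Open Scope ring_scope.
Local Open Scope fset_scope.

Section LimitFamily.
Variable R : realType.

(* L_r(n,1), for r, n >= 1 *)
Definition Ln (n r : nat) : galg R[i] finsets :=
  ((n%:R `^ (- (r%:R / 2)))%:C) *:
    \sum_(a : r.-tuple 'I_n | uniq a) gelt (tuple_set a).

(* R[i]^o: R[i] with the topology of its norm. *)
Definition Ln_law (n N : nat) (P : mpoly.mpoly N R[i]) : R[i]^o :=
  law gtrace (Ln n) P.

Local Open Scope classical_set_scope.

(* The joint distribution of (L_r)_{r >= 1} under psi is the pointwise limit of
   those of (L_r(n,1))_{r >= 1} under the trace. *)
Definition has_limit_law (A : comAlgType R[i]) (psi : A -> R[i])
    (L : nat -> A) : Prop :=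
  forall (N : nat) (P : mpoly.mpoly N R[i]),
    Ln_law n P @[n --> \oo] --> (law psi L P : R[i]^o).

End LimitFamily.

(* Main.v *)
(* Expanding the product of the L_(r_k)(n,1), the trace counts the tuples of
   indices in [1,n] that are injective on each block of positions and take each
   value an even number of times, divided by n^(|r|/2).  Sort them by their
   kernel pi: it has only blocks of even size, meets 1_r trivially, and comes
   from n (n - 1) ... (n - #pi + 1) tuples.  As #pi <= |r|/2, with equality
   exactly for pairings, only the elements of Pi_2(r) survive in the limit.

   For the cumulants, a pairing pi in Pi_2(r) determines the partition s of
   {1, ..., p} induced by the join of pi and 1_r, and is the disjoint union of
   one element of Pi_2^*(r_B) for each block B of s.  Hence #Pi_2 and #Pi_2^*
   are related by the moment-cumulant formula, which determines the cumulants
   from the moments and conversely. *)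
Require Import Defs.
From HB Require Import structures.
From mathcomp Require Import all_boot all_order all_algebra finmap.
Set Implicit Arguments.
Unset Strict Implicit.
Unset Printing Implicit Defensive.
Import Order.TTheory GRing.Theory Num.Theory.
Local Open Scope ring_scope.

(** * Pairings of colored points, and the lattice operations expressed by links *)

Section Linked.
Local Open Scope nat_scope.
Variables (T : finType) (I : eqType) (p : T -> I).
Implicit Types (pi : {set {set T}}) (D C : {set T}).

Definition linked pi (x y : T) := [exists C in pi, (x \in C) && (y \in C)].

(** When [pi] partitions [T], the components of this relation are the blocks of the join of [pi]
    with the partition by colors. *)
Definition linked_or_same_color pi : rel T :=
  [rel x y | linked pi x y || (p x == p y)].

Definition rainbow pi :=
  [forall x, forall y, linked pi x y ==> (p x == p y) ==> (x == y)].

Definition pairing D pi :=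
  [&& partition pi D, [forall C in pi, #|C| == 2] & rainbow pi].

(** Paths may a priori run through all of [T]; when [D] is a union of color classes, a path starting
    in [D] stays in [D]. *)
Definition connected_pairing D pi := pairing D pi &&
  [forall x in D, forall y in D, connect (linked_or_same_color pi) x y].

Lemma linkedP pi x y :
  reflect (exists C, [/\ C \in pi, x \in C & y \in C]) (linked pi x y).
Proof.
apply: (iffP exists_inP) => [[C Cpi /andP[xC yC]]|[C [Cpi xC yC]]].
  by exists C.
by exists C; rewrite ?xC.
Qed.

Lemma linkedC pi x y : linked pi x y = linked pi y x.
Proof. by apply/linkedP/linkedP => -[C [? ? ?]]; exists C. Qed.

Lemma rainbowP pi :
  reflect (forall x y, linked pi x y -> p x = p y -> x = y) (rainbow pi).
Proof.
apply: (iffP forallP) => [h x y lxy pxy|h x].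
  by have /forallP/(_ y) := h x; rewrite lxy pxy eqxx /= => /eqP.
by apply/forallP => y; apply/implyP => /h{}h; apply/implyP => /eqP/h/eqP.
Qed.

Lemma connect_linked pi x y :
  linked pi x y -> connect (linked_or_same_color pi) x y.
Proof. by move=> l; apply: connect1; rewrite /linked_or_same_color /= l. Qed.

Lemma connect_same_color pi x y :
  p x = p y -> connect (linked_or_same_color pi) x y.
Proof.
by move=> c; apply: connect1; rewrite /linked_or_same_color /= c eqxx orbT.
Qed.

Lemma linked_or_same_colorC pi : symmetric (linked_or_same_color pi).
Proof. by move=> x y; rewrite /linked_or_same_color /= linkedC eq_sym. Qed.

Lemma linked_pblock pi D x y :
  partition pi D -> x \in D -> (y \in pblock pi x) = linked pi x y.
Proof.
move=> ppi xD; have [/eqP cpi tpi _] := and3P ppi.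
have xpi : x \in cover pi by rewrite cpi.
apply/idP/linkedP => [yx|[C [Cpi xC yC]]].
  by exists (pblock pi x); rewrite pblock_mem // mem_pblock.
by rewrite (def_pblock tpi Cpi xC).
Qed.

(** The cell of the meet that contains [x] consists of the points linked to [x] and of the same
    color as [x]; both sides say that it is [{x}]. *)
Lemma part_meet_singletons pi : partition pi [set: T] ->
  (part_meet pi (preim_partition p [set: T]) == singletons T) = rainbow pi.
Proof.
move=> ppi; set Q := preim_partition p _.
have pQ : partition Q [set: T] by exact: preim_partitionP.
have QE x y : (y \in pblock Q x) = (p x == p y).
  by rewrite pblock_equivalence_partition ?inE // => ? ? ? _ _ _;
    split=> // /eqP->.
have [/eqP cpi tpi _] := and3P ppi; have [/eqP cQ tQ _] := and3P pQ.
apply/eqP/rainbowP => [eqm x y lxy pxy|rpi].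
  have xi : x \in pblock pi x by rewrite mem_pblock cpi inE.
  have : pblock pi x :&: pblock Q x \in part_meet pi Q.
    rewrite in_setD1; apply/andP; split.
      by apply/set0Pn; exists x; rewrite in_setI xi QE eqxx.
    by apply/imset2P; exists (pblock pi x) (pblock Q x);
      rewrite ?pblock_mem ?cpi ?cQ ?inE.
  rewrite eqm => /imsetP[z _ E].
  have /set1P -> : x \in [set z] by rewrite -E in_setI xi QE eqxx.
  have /set1P -> // : y \in [set z].
  by rewrite -E in_setI (linked_pblock _ ppi) ?inE // lxy QE pxy eqxx.
have cell x C D :
    C \in pi -> D \in Q -> x \in C -> x \in D -> C :&: D = [set x].
  move=> Cpi DQ xC xD; apply/setP => y; rewrite in_setI in_set1.
  apply/andP/eqP => [[yC yD]|->//]; apply/esym/rpi.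
    by apply/linkedP; exists C.
  by apply/eqP; rewrite -QE (def_pblock tQ DQ xD).
apply/setP => B; rewrite in_setD1;
  apply/andP/imsetP => [[B0 /imset2P[C D Cpi DQ E]]|[x _ ->]].
  have /set0Pn[x] := B0; rewrite E in_setI => /andP[xC xD]; exists x => //.
  exact: cell.
split; first by apply/set0Pn; exists x; rewrite in_set1.
apply/imset2P; exists (pblock pi x) (pblock Q x);
  rewrite ?pblock_mem ?cpi ?cQ ?inE //.
by rewrite (cell x) ?pblock_mem ?mem_pblock ?cpi ?cQ ?inE.
Qed.

(** On an empty [T] the join has no block at all, so the left side would fail while the right side
    holds vacuously. *)
Lemma part_join_full pi : 0 < #|T| -> partition pi [set: T] ->
  (part_join pi (preim_partition p [set: T]) == [set [set: T]]) =
    [forall x in [set: T], forall y in [set: T],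
       connect (linked_or_same_color pi) x y].
Proof.
move=> T0 ppi; set Q := preim_partition p _.
have QE x y : (y \in pblock Q x) = (p x == p y).
  by rewrite pblock_equivalence_partition ?inE // => ? ? ? _ _ _;
    split=> // /eqP->.
pose e := [rel x y | (y \in pblock pi x) || (y \in pblock Q x)].
have cE : connect e =2 connect (linked_or_same_color pi).
  by apply: eq_connect => x y /=; rewrite QE (linked_pblock _ ppi) ?inE.
apply/eqP/forall_inP => [E x _|h].
  apply/forall_inP => y _; rewrite -cE.
  have : [set z in [set: T] | connect e x z] \in part_join pi Q.
    by apply/imsetP; exists x; rewrite ?inE.
  by rewrite E => /set1P/setP/(_ y); rewrite !inE /= => ->.
have [x0 _] := card_gt0P T0.
have full x : [set z in [set: T] | connect e x z] = [set: T].
  by apply/setP => y; rewrite !inE cE /=; have /forall_inP := h x (in_setT x);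
    apply; rewrite inE.
apply/setP => B; rewrite in_set1; apply/imsetP/eqP => [[x _ ->]|->];
  first exact: full.
by exists x0; rewrite ?full ?inE.
Qed.

End Linked.

(** * Decomposition of a pairing into connected pairings *)

Section Decomposition.
Local Open Scope nat_scope.
Variables (T I : finType) (p : T -> I).
Hypothesis p_surj : forall i, exists x, p x = i.
Implicit Types (pi : {set {set T}}) (s : {set {set I}}) (B : {set I}).

(** Points of one color are always connected, so the choice of [x] and [y] does not matter;
    surjectivity of [p] makes [R] reflexive. *)
Let R pi : rel I := [rel i j | [exists x, exists y,
  [&& p x == i, p y == j & connect (linked_or_same_color p pi) x y]]].

Let connC pi : connect_sym (linked_or_same_color p pi).
Proof. exact/sym_connect_sym/linked_or_same_colorC. Qed.

Let RE pi x y : R pi (p x) (p y) = connect (linked_or_same_color p pi) x y.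
Proof.
apply/existsP/idP => [[x' /existsP[y' /and3P[/eqP xx' /eqP yy' c]]]|c].
  apply: (connect_trans (y := x')); first exact: connect_same_color.
  by apply: connect_trans c _; exact: connect_same_color.
by exists x; apply/existsP; exists y; rewrite !eqxx c.
Qed.

Let R_equiv pi : {in [set: I] & &, equivalence_rel (R pi)}.
Proof.
move=> i j k _ _ _; have [x <-] := p_surj i; have [y <-] := p_surj j.
have [z <-] := p_surj k; rewrite !RE; split; first exact: connect0.
by move=> c; exact: (same_connect (@connC pi)).
Qed.

(* The blocks of [pi \/ ker p], seen as sets of colors. *)
Definition color_partition pi := equivalence_partition (R pi) [set: I].

Lemma color_partitionP pi : partition (color_partition pi) [set: I].
Proof. exact/equivalence_partitionP/R_equiv. Qed.

(** A partition is recovered from its relation of lying in a common block, and by [p_surj] this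
    relation on colors can be tested on points. *)
Lemma color_partition_eq pi s : partition s [set: I] ->
  (color_partition pi == s) =
  [forall x, forall y,
     connect (linked_or_same_color p pi) x y == (p y \in pblock s (p x))].
Proof.
move=> ps; apply/eqP/forallP => [<- x|h].
  apply/forallP => y; apply/eqP.
  by rewrite pblock_equivalence_partition ?inE ?RE //; exact: R_equiv.
rewrite -(equivalence_partition_pblock ps); apply: eq_in_imset => i _.
apply/setP => j; rewrite !inE /=; have [x <-] := p_surj i;
  have [y <-] := p_surj j.
by have /forallP/(_ y)/eqP <- := h x; rewrite -RE.
Qed.

Section FixedPartition.
Variable s : {set {set I}}.
Hypothesis ps : partition s [set: I].

Let pieces B := [set pi | connected_pairing p (p @^-1: B) pi].
Let glued := [set pi | pairing p [set: T] pi && (color_partition pi == s)].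

(* A pairing with color partition s amounts to the choice, for each block B
   of s, of a connected pairing of the points colored in B. *)
Let glue (f : {ffun {set I} -> {set {set T}}}) : {set {set T}} :=
  \bigcup_(B in s) f B.
(** The value [set0] off [s] is the default required by [pfamily]; it makes the function unique. *)
Let split_pairing (pi : {set {set T}}) : {ffun {set I} -> {set {set T}}} :=
  [ffun B => if B \in s then [set C in pi | C \subset p @^-1: B] else set0].

Let s_triv : trivIset s. Proof. by case/and3P: ps. Qed.
Let s_cover i : i \in cover s.
Proof. by case/and3P: ps => /eqP->; rewrite inE. Qed.

Let family_pieces (f : {ffun {set I} -> {set {set T}}}) B :
  f \in pfamily set0 (mem s) (fun B => mem (pieces B)) -> B \in s ->
  connected_pairing p (p @^-1: B) (f B).
Proof. by case/pfamilyP => _ h /h; rewrite inE. Qed.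

Let piece_sub B pi C : connected_pairing p (p @^-1: B) pi -> C \in pi ->
  C \subset p @^-1: B.
Proof.
by case/andP => /and3P[/and3P[/eqP<- _ _] _ _] _ Cpi; exact: bigcup_sup.
Qed.

Let piece_neq0 B pi C : connected_pairing p (p @^-1: B) pi -> C \in pi ->
  exists x, x \in C.
Proof.
case/andP => /and3P[/and3P[_ _ pi0] _ _] _ Cpi; apply/set0Pn/eqP => C0.
by rewrite -C0 Cpi in pi0.
Qed.

Let same_block B B' i : B \in s -> B' \in s -> i \in B -> i \in B' -> B = B'.
Proof.
move=> Bs B's iB iB'.
by rewrite -(def_pblock s_triv Bs iB) (def_pblock s_triv B's iB').
Qed.

Let glueP (f : {ffun {set I} -> {set {set T}}}) C :
  reflect (exists2 B, B \in s & C \in f B) (C \in glue f).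
Proof. exact: bigcupP. Qed.

Let glue_sub (f : {ffun {set I} -> {set {set T}}}) :
  f \in pfamily set0 (mem s) (fun B => mem (pieces B)) ->
  glue f \in glued.
Proof.
move=> ff; have fP := family_pieces ff.
(* The color of a common point lies in only one block of [s], so both blocks come from the same
   piece, which is a partition. *)
have disj C C' x :
    C \in glue f -> C' \in glue f -> x \in C -> x \in C' -> C = C'.
  case/glueP => B Bs CB /glueP[B' B's C'B'] xC xC'.
  have /subsetP/(_ _ xC) := piece_sub (fP _ Bs) CB; rewrite inE => xB.
  have /subsetP/(_ _ xC') := piece_sub (fP _ B's) C'B'; rewrite inE => xB'.
  have E := same_block Bs B's xB xB'; subst B'.
  have /andP[/and3P[/and3P[_ t _] _ _] _] := fP _ Bs.
  by rewrite -(def_pblock t CB xC) (def_pblock t C'B' xC').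
have pg : partition (glue f) [set: T].
  apply/and3P; split.
  - apply/eqP/setP => x; rewrite inE; have [B Bs xB] := bigcupP (s_cover (p x)).
    have /andP[/and3P[/and3P[/eqP c _ _] _ _] _] := fP _ Bs.
    have : x \in cover (f B) by rewrite c inE.
    case/bigcupP => C CB xC; apply/bigcupP; exists C => //.
    by apply/glueP; exists B.
  - apply/trivIsetP => C C' Cg C'g; apply: contraR => /pred0Pn[x /andP[xC xC']].
    by apply/eqP; exact: disj xC xC'.
  - by apply/negP => /glueP[B Bs] /(piece_neq0 (fP _ Bs))[x]; rewrite inE.
have link_block x y : linked (glue f) x y ->
    exists2 B, B \in s & [/\ p x \in B, p y \in B & linked (f B) x y].
  case/linkedP => C [/glueP[B Bs CB] xC yC]; exists B => //.
  have /subsetP sub := piece_sub (fP _ Bs) CB; split.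
  - by have := sub _ xC; rewrite inE.
  - by have := sub _ yC; rewrite inE.
  - by apply/linkedP; exists C.
rewrite inE color_partition_eq //; apply/andP; split.
  apply/and3P; split=> //.
    apply/forall_inP => C /glueP[B Bs CB].
    by have /andP[/and3P[_ /forall_inP/(_ _ CB)]] := fP _ Bs.
  apply/rainbowP => x y /link_block[B Bs [_ _ lxy]].
  by have /andP[/and3P[_ _ /rainbowP/(_ _ _ lxy)]] := fP _ Bs.
apply/forallP => x; apply/forallP => y; apply/eqP; apply/idP/idP => [c|pxy].
  (* Each link of [glue f] lives over a single block of [s], hence no path leaves the points colored
     in that block. *)
  have : closed (linked_or_same_color p (glue f)) [pred z |
    p z \in pblock s (p x)].
    apply: intro_closed; first exact/sym_connect_sym/linked_or_same_colorC.
    move=> z t; rewrite !inE => /orP[/link_block[B Bs [zB tB _]] zx|/eqP-> //].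
    by rewrite (same_block _ Bs zx zB) ?pblock_mem.
  by move/closed_connect/(_ _ _ c); rewrite !inE mem_pblock s_cover => <-.
(* Conversely, the piece over [B] is connected, and its links are links of [glue f]. *)
have [B Bs xB] := bigcupP (s_cover (p x)).
rewrite (def_pblock s_triv Bs xB) in pxy.
have /andP[_ /forall_inP/(_ x)] := fP _ Bs; rewrite inE xB => /(_ isT).
move/forall_inP/(_ y); rewrite inE pxy => /(_ isT).
apply: connect_sub => z t /orP[/linkedP[C [CB zC tC]]|/eqP];
  last exact: connect_same_color.
by apply: connect_linked; apply/linkedP; exists C; split=> //; apply/glueP;
  exists B.
Qed.

Let split_sub pi : pi \in glued ->
  split_pairing pi \in pfamily set0 (mem s) (fun B => mem (pieces B)).
Proof.
rewrite inE => /andP[/and3P[ppi /forall_inP pi2 /rainbowP rpi]].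
rewrite color_partition_eq // => /forallP h.
have {h}cE x y :
    connect (linked_or_same_color p pi) x y = (p y \in pblock s (p x)).
  by have /forallP/(_ y)/eqP := h x.
have [/eqP cpi tpi pi0] := and3P ppi.
have linked_block B x y : B \in s -> linked pi x y -> p x \in B -> p y \in B.
  move=> Bs lxy xB; have := cE x y.
  by rewrite (def_pblock s_triv Bs xB) connect_linked // => <-.
apply/pfamilyP; split=> [|B Bs]; first by apply/subsetP => B;
  rewrite inE ffunE; case: ifP => //; rewrite eqxx.
(* Restriction loses no link over [B]: a block of [pi] with one point colored in [B] has all its
   points colored in [B]. *)
have lE x y : p x \in B -> linked (split_pairing pi B) x y = linked pi x y.
  move=> xB; apply/linkedP/linkedP => [[C [CB xC yC]]|[C [Cpi xC yC]]].
    by exists C; split=> //; move: CB; rewrite ffunE Bs inE => /andP[].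
  exists C; split=> //; rewrite ffunE Bs inE Cpi; apply/subsetP => z zC.
  by rewrite inE (linked_block _ x) //; apply/linkedP; exists C.
have sub_pi C : C \in split_pairing pi B -> C \in pi /\ C \subset p @^-1: B.
  by rewrite ffunE Bs inE => /andP.
rewrite inE; apply/andP; split; first apply/and3P; first split;
  first apply/and3P; first split.
- apply/eqP/setP => x; apply/bigcupP/idP => [[C /sub_pi[_ /subsetP CB] /CB]//|].
  rewrite inE => xB; have : linked (split_pairing pi B) x x.
    by rewrite lE // -(linked_pblock _ ppi) ?mem_pblock ?cpi inE.
  by case/linkedP => C [CB xC _]; exists C.
- apply: trivIsetS tpi; apply/subsetP => C /sub_pi[]//.
- by apply/negP => /sub_pi[pi0']; rewrite pi0' in pi0.
- by apply/forall_inP => C /sub_pi[/pi2].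
- apply/rainbowP => x y lxy; apply: rpi.
  have [C [/sub_pi[_ /subsetP CB] xC _]] := linkedP _ _ _ lxy.
  by rewrite -lE //; have := CB _ xC; rewrite inE.
apply/forall_inP => x; rewrite inE => xB; apply/forall_inP => y;
  rewrite inE => yB.
have : connect (linked_or_same_color p pi) x y.
  by rewrite cE (def_pblock s_triv Bs xB).
(* A path for [pi] that starts over [B] never leaves it, so by [lE] it is also a path for the
   restriction. *)
case/connectP => q; elim: q x xB => [|z q IH] x xB /=; first by move=> _ ->.
case/andP => /orP xz qz yE.
have zB : p z \in B by case: xz => [/linked_block|/eqP<-//]; apply.
apply: connect_trans (IH z zB qz yE); case: xz => [l|/eqP];
  last exact: connect_same_color.
by apply: connect_linked; rewrite lE.
Qed.

Let split_pairingK pi : pi \in glued -> glue (split_pairing pi) = pi.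
Proof.
move=> pig; have := pig; rewrite inE => /andP[/and3P[ppi _ _]].
rewrite color_partition_eq // => /forallP h.
have [_ _ pi0] := and3P ppi.
apply/setP => C; apply/glueP/idP => [[B Bs]|Cpi];
  first by rewrite ffunE Bs inE => /andP[].
have [x xC] : exists x, x \in C by apply/set0Pn/eqP => C0;
  rewrite -C0 Cpi in pi0.
exists (pblock s (p x)); first by rewrite pblock_mem.
rewrite ffunE pblock_mem // inE Cpi; apply/subsetP => y yC; rewrite inE.
have /forallP/(_ y)/eqP <- := h x.
by apply: connect_linked; apply/linkedP; exists C.
Qed.

Let glueK (f : {ffun {set I} -> {set {set T}}}) :
  f \in pfamily set0 (mem s) (fun B => mem (pieces B)) ->
  split_pairing (glue f) = f.
Proof.
move=> ff; have fP := family_pieces ff; apply/ffunP => B; rewrite ffunE.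
case: ifPn => Bs; last first.
  by have /pfamilyP[/supportP/(_ _ Bs)] := ff.
apply/setP => C; rewrite inE; apply/andP/idP => [[/glueP[B' B's CB'] CB]|CB].
  have [x xC] := piece_neq0 (fP _ B's) CB'.
  have := subsetP (piece_sub (fP _ B's) CB') _ xC; rewrite inE => xB'.
  have := subsetP CB _ xC; rewrite inE => xB.
  by rewrite (same_block Bs B's xB xB').
by split; [apply/glueP; exists B | exact: piece_sub (fP _ Bs) CB].
Qed.

Lemma card_color_partition :
  #|[set pi | pairing p [set: T] pi && (color_partition pi == s)]| =
  \prod_(B in s) #|[set pi | connected_pairing p (p @^-1: B) pi]|.
Proof.
transitivity #|pfamily set0 (mem s) (fun B => mem (pieces B))|; last first.
  by rewrite card_pfamily foldrE big_map big_enum.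
rewrite -(card_in_imset (can_in_inj glueK)); apply: eq_card => pi.
apply/idP/imsetP => [pig|[f ff ->]]; last exact: glue_sub.
by exists (split_pairing pi); rewrite ?split_pairingK ?split_sub.
Qed.

End FixedPartition.

(** This is the moment-cumulant formula for the numbers of pairings, obtained by sorting them by
    color partition. *)
Lemma card_pairing_partition :
  #|[set pi | pairing p [set: T] pi]| =
  \sum_(s : {set {set I}} | partition s [set: I])
    \prod_(B in s) #|[set pi | connected_pairing p (p @^-1: B) pi]|.
Proof.
rewrite -sum1_card (partition_big color_partition
  (fun s => partition s [set: I])) /=; last first.
  by move=> pi _; exact: color_partitionP.
apply: eq_bigr => s ps; rewrite -card_color_partition // sum1dep_card.
by apply: eq_card => pi; rewrite !inE.
Qed.

End Decomposition.

(** * Transport of connected pairings along an injection *)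

Section Transport.
Local Open Scope nat_scope.
Variables (T T' : finType) (I I' : eqType) (p : T -> I) (p' : T' -> I').
Variable h : T' -> T.
Hypothesis h_inj : injective h.
Hypothesis h_color : forall x y, (p (h x) == p (h y)) = (p' x == p' y).
(** The image of [h] is a union of color classes, so that paths between image points cannot escape
    from it. *)
Hypothesis h_saturated : forall x y, p (h x) = p y -> y \in (h @: [set: T']).

Let push (pi : {set {set T'}}) : {set {set T}} :=
  [set h @: C | C : {set T'} in pi].

Let linked_push pi x y : linked (push pi) (h x) (h y) = linked pi x y.
Proof.
apply/linkedP/linkedP => [[_ [/imsetP[C Cpi ->]]]|[C [Cpi xC yC]]].
  by rewrite !(mem_imset _ _ h_inj) => xC yC; exists C.
by exists (h @: C); rewrite !(mem_imset _ _ h_inj) imset_f.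
Qed.

Let linked_push_image pi x y : linked (push pi) x y -> y \in (h @: [set: T']).
Proof.
case/linkedP => _ [/imsetP[C _ ->] _ /imsetP[z _ ->]]; by rewrite imset_f ?inE.
Qed.

Let connect_push pi x y :
  connect (linked_or_same_color p (push pi)) (h x) (h y) =
  connect (linked_or_same_color p' pi) x y.
Proof.
apply/idP/idP.
  case/connectP => q; elim: q x => [|z q IH] x /=; first by move=> _ /h_inj ->.
  case/andP => xz qz yE; have /imsetP[t _ zE] : z \in (h @: [set: T']).
    by case/orP: xz => [/linked_push_image|/eqP/h_saturated].
  subst z; apply: connect_trans (IH t qz yE); case/orP: xz => [|].
    by rewrite linked_push; exact: connect_linked.
  by rewrite h_color => /eqP; exact: connect_same_color.
case/connectP => q; elim: q x => [|z q IH] x /=; first by move=> _ ->.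
case/andP => xz qz yE; apply: connect_trans (IH z qz yE); case/orP: xz => [l|c].
  by apply: connect_linked; rewrite linked_push.
by apply: connect_same_color; apply/eqP; rewrite h_color.
Qed.

Let partition_push pi :
  partition (push pi) (h @: [set: T']) = partition pi [set: T'].
Proof.
have coverE : cover (push pi) = h @: cover pi.
  apply/setP => x; apply/bigcupP/imsetP =>
    [[_ /imsetP[C Cpi ->] /imsetP[z zC ->]]|].
    by exists z => //; apply/bigcupP; exists C.
  case=> z /bigcupP[C Cpi zC] ->.
  by exists (h @: C); rewrite ?imset_f.
congr [&& _, _ & _].
- by rewrite coverE (inj_eq (imset_inj h_inj)).
- apply/trivIsetP/trivIsetP => t C C' Cpi C'pi; last first.
    case/imsetP: Cpi => D Dpi ->; case/imsetP: C'pi => D' D'pi ->.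
    rewrite (inj_eq (imset_inj h_inj)) => /(t _ _ Dpi D'pi).
    by rewrite -!setI_eq0 -imsetI ?imset_eq0 // => ? ? _ _ /h_inj.
  move=> CC'; have := t _ _ (imset_f _ Cpi) (imset_f _ C'pi).
  rewrite (inj_eq (imset_inj h_inj)) => /(_ CC').
  by rewrite -!setI_eq0 -imsetI ?imset_eq0 // => ? ? _ _ /h_inj.
congr (~~ _); apply/imsetP/idP => [[C Cpi /esym/eqP]|s0].
  by rewrite imset_eq0 => /eqP <-.
by exists set0 => //; rewrite imset0.
Qed.

Lemma connected_pairing_imset (pi : {set {set T'}}) :
  connected_pairing p (h @: [set: T']) [set h @: C | C : {set T'} in pi] =
  connected_pairing p' [set: T'] pi.
Proof.
rewrite /connected_pairing /pairing partition_push; congr (_ && (_ && _) && _).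
- apply/forall_inP/forall_inP => t C Cpi.
    by have := t _ (imset_f _ Cpi); rewrite card_imset.
  by case/imsetP: Cpi => D /t Dpi ->; rewrite card_imset.
- apply/rainbowP/rainbowP => rpi x y lxy pxy.
    by apply/h_inj/rpi; rewrite ?linked_push //; apply/eqP; rewrite h_color pxy.
  have /imsetP[x' _ xE] : x \in (h @: [set: T']).
    by apply: (@linked_push_image pi y); rewrite linkedC.
  have /imsetP[y' _ yE] := linked_push_image lxy.
  move: lxy pxy; rewrite xE yE linked_push => lxy /eqP;
    rewrite h_color => /eqP pxy.
  by congr h; exact: rpi.
apply/forall_inP/forall_inP => t x xD; apply/forall_inP => y yD.
  have /forall_inP/(_ (h y)) := t _ (imset_f h xD).
  by rewrite imset_f // connect_push => /(_ isT).
case/imsetP: xD => x' _ ->; case/imsetP: yD => y' _ ->; rewrite connect_push.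
by have /forall_inP := t x' (in_setT x'); apply; rewrite inE.
Qed.

Lemma card_connected_pairing_imset :
  #|[set pi | connected_pairing p (h @: [set: T']) pi]| =
  #|[set pi | connected_pairing p' [set: T'] pi]|.
Proof.
rewrite -(card_imset _ (imset_inj (imset_inj h_inj))); apply: eq_card => pi.
rewrite inE; apply/idP/imsetP => [cpi|[pi' + ->]]; last first.
  by rewrite inE connected_pairing_imset.
(* Every block of [pi] lies in the image of [h], hence is the image of its own preimage. *)
have : [set h @: C | C : {set T'} in [set h @^-1: C | C : {set T} in pi]] = pi.
  rewrite -imset_comp -[RHS]imset_id; apply: eq_in_imset => C Cpi /=.
  have /subsetP CD : C \subset (h @: [set: T']).
    have /andP[/and3P[/and3P[/eqP <- _ _] _ _] _] := cpi; exact: bigcup_sup.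
  apply/setP => x; apply/imsetP/idP => [[z + ->]|xC]; first by rewrite inE.
  by have /imsetP[z _ xE] := CD _ xC; exists z; rewrite // inE -xE.
move=> E; exists [set h @^-1: C | C : {set T} in pi]; last by rewrite E.
by rewrite inE -connected_pairing_imset E.
Qed.

End Transport.

(** * The sets [Pi2] and [Pi2star] as sets of pairings, and their subvectors *)

Section PairingsOfVector.
Local Open Scope nat_scope.

Lemma Pi2E r (pi : {set {set 'I_(sumn r)}}) :
  (pi \in Pi2 r) = pairing (@f_vec r) [set: 'I_(sumn r)] pi.
Proof.
rewrite inE /pairing; have [ppi /=|//] := boolP (partition _ _).
by rewrite /vec_part part_meet_singletons.
Qed.

Lemma Pi2starE r (pi : {set {set 'I_(sumn r)}}) : 0 < sumn r ->
  (pi \in Pi2star r) = connected_pairing (@f_vec r) [set: 'I_(sumn r)] pi.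
Proof.
move=> r0; rewrite inE Pi2E /connected_pairing;
  case: (boolP (pairing _ _ _)) => //.
by case/and3P => ppi _ _ /=; rewrite /vec_part part_join_full ?card_ord.
Qed.

Section Subvector.
Variable r : seq nat.

(** This is [f_vec] with values in a finite type, onto which it is surjective when all entries of
    [r] are positive, as the decomposition requires. *)
Definition vec_block (x : 'I_(sumn r)) : 'I_(size r) :=
  Ordinal (reshape_indexP (ltn_ord x)).

Lemma vec_block_surj : all (leq 1) r -> forall i, exists x, vec_block x = i.
Proof.
move=> /all_nthP r1 i; have ri : 0 < nth 0 r i by exact: r1.
(* The witness is the first position of block [i]. *)
by exists (Ordinal (flatten_indexP ri)); apply: val_inj;
  rewrite /= flatten_indexKl.
Qed.

Variable B : {set 'I_(size r)}.
Let rB := [seq nth 0 r i | i : 'I_(size r) <- enum B].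
(* The k-th element of B; [emb] below is the increasing bijection from the
   positions of rB to the positions of r whose block lies in B. *)
Let idx k := nth 0 [seq val i | i <- enum B] k.

Let idx_ltP k : k < size rB ->
  exists2 i, i \in B &
    [/\ val i = idx k, nth 0 rB k = nth 0 r i & k = index i (enum B)].
Proof.
rewrite size_map => kB; case E: (enum B) (kB) => [//|i0 s]; rewrite -E => _.
exists (nth i0 (enum B) k); first by rewrite -mem_enum mem_nth.
by split; rewrite ?index_uniq ?enum_uniq // /idx /rB (nth_map i0).
Qed.

Let emb_lt (z : 'I_(sumn rB)) :
  flatten_index r (idx (reshape_index rB z)) (reshape_offset rB z) < sumn r.
Proof.
apply: flatten_indexP; have [i _ [<- <- _]] :=
  idx_ltP (reshape_indexP (ltn_ord z)).
exact: reshape_offsetP.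
Qed.

Let emb z := Ordinal (emb_lt z).

(** A position is determined by its block and its offset there, so these equations give the
    injectivity and the image of [emb]. *)
Let embK (z : 'I_(sumn rB)) : reshape_offset r (emb z) = reshape_offset rB z /\
  (vec_block (emb z) \in B /\
   index (vec_block (emb z)) (enum B) = reshape_index rB z).
Proof.
have [i iB [ie ri ki]] := idx_ltP (reshape_indexP (ltn_ord z)).
have lt : reshape_offset rB z < nth 0 r (idx (reshape_index rB z)).
  by rewrite -ie -ri; exact: reshape_offsetP.
have -> : vec_block (emb z) = i by apply: val_inj; rewrite /= flatten_indexKl.
by rewrite flatten_indexKr.
Qed.

Let emb_inj : injective emb.
Proof.
move=> z t zt; apply: ord_inj.
rewrite -(reshape_indexK rB z) -(reshape_indexK rB t).
have [<- [_ <-]] := embK z; have [<- [_ <-]] := embK t.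
by rewrite zt.
Qed.

Let emb_image : emb @: [set: 'I_(sumn rB)] = vec_block @^-1: B.
Proof.
apply/setP => x; rewrite inE; apply/imsetP/idP => [[z _ ->]|xB].
  by have [_ []] := embK z.
have xe : vec_block x \in enum B by rewrite mem_enum.
pose k := index (vec_block x) (enum B).
have kB : k < size rB by rewrite size_map index_mem.
have ik : idx k = vec_block x.
  by rewrite /idx (nth_map (vec_block x)) ?index_mem // nth_index.
have rk : reshape_offset r x < nth 0 rB k.
  rewrite /rB (nth_map (vec_block x)) ?index_mem // nth_index //.
  exact: reshape_offsetP.
exists (Ordinal (flatten_indexP rk)); rewrite ?inE //; apply: val_inj => /=.
by rewrite flatten_indexKl // flatten_indexKr // ik reshape_indexK.
Qed.

Lemma card_Pi2star_subvector : all (leq 1) r -> B != set0 ->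
  #|Pi2star rB| =
  #|[set pi | connected_pairing vec_block (vec_block @^-1: B) pi]|.
Proof.
move=> r1 /set0Pn[i iB]; rewrite -emb_image.
have r0 : 0 < sumn rB.
  rewrite lt0n; apply/eqP => /eqP; rewrite sumnE big_map sum_nat_seq_eq0.
  move/allP/(_ i); rewrite mem_enum => /(_ iB).
  by rewrite eqn0Ngt; have /all_nthP := r1; move=> /(_ 0) ->.
rewrite (@card_connected_pairing_imset _ _ _ _ vec_block (@f_vec rB) emb
  emb_inj).
- by apply: eq_card => pi; rewrite Pi2starE ?inE.
- move=> x y; apply/eqP/eqP; rewrite /f_vec.
    have [_ [_ <-]] := embK x; have [_ [_ <-]] := embK y.
    by move=> ->.
  move=> xy; have [_ [xB ix]] := embK x; have [_ [yB iy]] := embK y.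
  have xe : vec_block (emb x) \in enum B by rewrite mem_enum.
  have ye : vec_block (emb y) \in enum B by rewrite mem_enum.
  by rewrite -(nth_index (vec_block (emb x)) xe) ix xy -iy nth_index.
- move=> x y xy; rewrite emb_image inE -xy.
  by have [_ []] := embK x.
Qed.

End Subvector.

(** The separate [m] allows the partitions to live on ['I_(size [seq L k | k <- r])], as in the
    moment-cumulant formula, without a cast. *)
Lemma card_Pi2_partition r m : m = size r -> all (leq 1) r ->
  #|Pi2 r| = \sum_(s : {set {set 'I_m}} | partition s [set: 'I_m])
    \prod_(B in s) #|Pi2star [seq nth 0 r i | i : 'I_m <- enum B]|.
Proof.
move=> -> r1.
transitivity #|[set pi | pairing (@vec_block r) [set: 'I_(sumn r)] pi]|.
  by apply: eq_card => pi; rewrite Pi2E inE.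
rewrite (card_pairing_partition (vec_block_surj r1)).
apply: eq_bigr => s /and3P[_ _ s0]; apply: eq_bigr => B Bs.
by rewrite card_Pi2star_subvector //; apply: contraNneq s0 => <-.
Qed.

End PairingsOfVector.

(** * Counting functions with a given kernel *)

Section Kernel.
Local Open Scope nat_scope.
Variables (T J : finType).

Lemma linked_kernel (f : T -> J) x y :
  linked (preim_partition f [set: T]) x y = (f x == f y).
Proof.
rewrite -(linked_pblock _ (preim_partitionP f _)) ?inE //.
by rewrite pblock_equivalence_partition ?inE // => ? ? ? _ _ _;
  split=> // /eqP->.
Qed.

Lemma preim_partition_eq (f : T -> J) (pi : {set {set T}}) :
  partition pi [set: T] -> (forall x y, linked pi x y = (f x == f y)) ->
  preim_partition f [set: T] = pi.
Proof.
move=> ppi h; rewrite -[RHS](equivalence_partition_pblock ppi).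
apply: eq_in_imset => x _; apply/setP => y.
by rewrite !inE (linked_pblock _ ppi) ?inE // h.
Qed.

(** A function with kernel [pi] is the same as an injective function on the blocks of [pi]. *)
Lemma card_ffun_kernel (pi : {set {set T}}) : partition pi [set: T] ->
  #|[set f : {ffun T -> J} | preim_partition f [set: T] == pi]| = #|J| ^_ #|pi|.
Proof.
move=> ppi; have [/eqP cpi tpi pi0] := and3P ppi.
have bP x : pblock pi x \in pi by rewrite pblock_mem // cpi inE.
pose b x : {B | B \in pi} := Sub (pblock pi x) (bP x).
have bE x y : (b x == b y) = linked pi x y.
  rewrite -val_eqE /= eq_pblock ?cpi ?inE // (linked_pblock _ ppi) ?inE //.
have b_surj u : exists x, b x = u.
  have /set0Pn[x xu] : val u != set0.
    by apply: contraNneq pi0 => <-; exact: valP.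
  by exists x; apply: val_inj; rewrite /= (def_pblock tpi (valP u) xu).
pose ext (g : {ffun {B | B \in pi} -> J}) : {ffun T -> J} :=
  [ffun x => g (b x)].
have ext_inj : injective ext.
  move=> g g' /ffunP E; apply/ffunP => u; have [x <-] := b_surj u.
  by have := E x; rewrite !ffunE.
rewrite -(card_sig (mem pi)) -card_inj_ffuns -(card_imset _ ext_inj).
apply: eq_card => f; rewrite inE; apply/eqP/imsetP => [kf|[g + ->]].
  have lE x y : linked pi x y = (f x == f y) by rewrite -kf linked_kernel.
  have fP u : exists j, [exists x, (b x == u) && (f x == j)].
    by have [x <-] := b_surj u; exists (f x); apply/existsP; exists x;
      rewrite !eqxx.
  (* The value on a block is that of [f] at any of its points, as [f] is constant there. *)
  pose g := [ffun u => xchoose (fP u)].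
  have gE x : g (b x) = f x.
    rewrite ffunE; have /existsP[y /andP[bxy /eqP <-]] := xchooseP (fP (b x)).
    by apply/eqP; rewrite -lE -bE.
  exists g; last by apply/ffunP => x; rewrite ffunE gE.
  rewrite inE; apply/injectiveP => u v; have [x <-] := b_surj u.
  by have [y <-] := b_surj v; rewrite !gE => /eqP; rewrite -lE -bE => /eqP.
rewrite inE => /injectiveP g_inj; apply: preim_partition_eq => // x y.
by rewrite !ffunE (inj_eq g_inj) bE.
Qed.

End Kernel.

(** * Kernels of the index tuples that contribute to the trace *)

Section TupleKernel.
Local Open Scope nat_scope.

Lemma card_tuple_kernel (J : finType) d (pi : {set {set 'I_d}}) :
  partition pi [set: 'I_d] ->
  #|[set a : d.-tuple J | preim_partition (tnth a) [set: 'I_d] == pi]| =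
    #|J| ^_ #|pi|.
Proof.
move=> ppi; rewrite -card_ffun_kernel //.
pose F (a : d.-tuple J) := [ffun i => tnth a i].
have FE (a : d.-tuple J) :
    preim_partition (F a) [set: 'I_d] = preim_partition (tnth a) [set: 'I_d].
  by apply: eq_in_imset => x _; apply/setP => y; rewrite !inE !ffunE.
have F_inj : injective F.
  by move=> a a' /ffunP E; apply: eq_from_tnth => i; have := E i;
    rewrite !ffunE.
rewrite -(card_imset _ F_inj); apply: eq_card => f; rewrite inE.
apply/imsetP/eqP => [[a + ->]|<-]; first by rewrite inE FE => /eqP.
have E : f = F [tuple f i | i < d].
  by apply/ffunP => i; rewrite ffunE tnth_mktuple.
by exists [tuple f i | i < d] => //; rewrite inE -FE -E.
Qed.

(* The kernels of the index tuples that contribute to the trace of a product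
   of the L_r(n,1): each value must occur an even number of times for the
   symmetric difference to vanish. *)
Definition even_rainbow r : {set {set {set 'I_(sumn r)}}} :=
  [set pi | [&& partition pi [set: 'I_(sumn r)],
                [forall B in pi, ~~ odd #|B|] & rainbow (@f_vec r) pi]].

Section EvenRainbow.
Variable r : seq nat.
Implicit Types pi : {set {set 'I_(sumn r)}}.

(** The size [sumn r] is the sum of the block sizes, which are even and nonzero, hence at least 2;
    equality holds exactly when all of them are 2. *)
Lemma card_even_rainbow pi : pi \in even_rainbow r ->
  [/\ ~~ odd (sumn r), #|pi| <= (sumn r)./2 &
      (#|pi| == (sumn r)./2) = (pi \in Pi2 r)].
Proof.
move=> pir; have := pir; rewrite inE => /and3P[ppi /forall_inP ev rpi].
have sE : sumn r = \sum_(B in pi) #|B|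
  by rewrite -(card_partition ppi) cardsT card_ord.
have [_ _ pi0] := and3P ppi.
have B2 B : B \in pi -> 2 <= #|B| ?= iff (#|B| == 2).
  move=> Bpi; split; last by rewrite eq_sym.
  have := ev _ Bpi; have : 0 < #|B|.
    by rewrite card_gt0; apply: contraNneq pi0 => <-.
  by case: #|B| => [|[|k]].
have osum : ~~ odd (sumn r).
  rewrite sE; apply: (big_ind (fun m => ~~ odd m)) => // m n.
  by rewrite oddD => /negbTE -> /negbTE ->.
have dbl : (sumn r)./2.*2 = sumn r.
  by rewrite -[RHS]odd_double_half (negbTE osum).
have := leqif_sum B2; rewrite sum_nat_const -sE muln2 => -[le eq].
split=> //; first by rewrite -leq_double dbl.
rewrite -(inj_eq double_inj) dbl eq Pi2E /pairing ppi rpi andbT.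
by apply/forall_inP/forall_inP.
Qed.

Lemma Pi2_even_rainbow pi : pi \in Pi2 r -> pi \in even_rainbow r.
Proof.
rewrite Pi2E inE => /and3P[-> /forall_inP h ->]; rewrite andbT.
by apply/forall_inP => B /h /eqP ->.
Qed.

Section Tuple.
Variables (n : nat) (a : (sumn r).-tuple 'I_n.+1).

Let shE : shape (reshape r a) = r.
Proof. by apply: reshapeKl; rewrite size_tuple. Qed.
Let flE : flatten (reshape r a) = a.
Proof. by apply: reshapeKr; rewrite size_tuple. Qed.

(** The sequences of [reshape r a] are the restrictions of [a] to the color classes, and positions
    are linked by the kernel when their entries agree. Taking ['I_n.+1] provides the default entry
    [ord0]. *)
Lemma uniq_reshape_rainbow :
  all uniq (reshape r a) =
  rainbow (@f_vec r) (preim_partition (tnth a) [set: 'I_(sumn r)]).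
Proof.
have aE (i : 'I_(sumn r)) :
    tnth a i = nth ord0 (nth [::] (reshape r a) (reshape_index r i))
                 (reshape_offset r i).
  by rewrite (tnth_nth ord0) -[in LHS]flE nth_flatten shE.
have szE k : size (nth [::] (reshape r a) k) = nth 0 r k.
  by rewrite -[in RHS]shE nth_shape.
have szr : size (reshape r a) = size r by rewrite -[in RHS]shE size_map.
apply/(all_nthP [::])/rainbowP => [h i j|h k].
  rewrite linked_kernel /f_vec => /eqP + ij; rewrite !aE -ij.
  have ki : reshape_index r i < size (reshape r a).
    by rewrite szr reshape_indexP.
  move/(uniqP _ (h _ ki)); rewrite !inE !szE {2}ij !reshape_offsetP // =>
    /(_ isT isT) oij.
  by apply: ord_inj; rewrite -(reshape_indexK r i) oij ij reshape_indexK.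
rewrite szr => kr; apply/(uniqP ord0) => c c'; rewrite !inE !szE => ck c'k cc'.
have := h (Ordinal (flatten_indexP ck)) (Ordinal (flatten_indexP c'k)).
rewrite linked_kernel /f_vec !aE /= !flatten_indexKl // !flatten_indexKr // cc'
  eqxx.
by move=> /(_ isT erefl) /(congr1 (fun x => reshape_offset r (val x)));
  rewrite /= !flatten_indexKr.
Qed.

Lemma even_count_kernel :
  [forall x, ~~ odd (count_mem x a)] =
  [forall B in preim_partition (tnth a) [set: 'I_(sumn r)], ~~ odd #|B|].
Proof.
have cE x : count_mem x a = #|[set i | x == tnth a i]|.
  by rewrite -sum1_count big_tuple -sum1dep_card; apply: eq_bigl => i;
    rewrite /= eq_sym.
apply/forallP/forall_inP => [h B /imsetP[i _ ->]|h x].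
  have -> : [set j in [set: 'I_(sumn r)] | tnth a i == tnth a j]
    = [set j | tnth a i == tnth a j].
    by apply/setP => j; rewrite !inE.
  by rewrite -cE.
(* The fibers of [a] are the blocks of its kernel, except the empty ones, whose size 0 is even
   anyway. *)
rewrite cE; have [->|[i]] := set_0Vmem [set i | x == tnth a i];
  first by rewrite cards0.
rewrite inE => /eqP xE; apply: h; apply/imsetP; exists i; rewrite ?inE //.
by apply/setP => j; rewrite !inE xE.
Qed.

End Tuple.

Lemma card_even_rainbow_tuples n :
  #|[set a : (sumn r).-tuple 'I_n.+1 |
      all uniq (reshape r a) && [forall x, ~~ odd (count_mem x a)]]| =
  \sum_(pi in even_rainbow r) n.+1 ^_ #|pi|.
Proof.
rewrite -sum1_card (partition_big (fun a : (sumn r).-tuple 'I_n.+1 =>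
  preim_partition (tnth a) [set: 'I_(sumn r)]) (mem (even_rainbow r))) /=.
  apply: eq_bigr => pi pir; have := pir; rewrite inE => /and3P[ppi ev rpi].
  have := card_tuple_kernel 'I_n.+1 ppi; rewrite card_ord => <-.
  rewrite sum1dep_card; apply: eq_card => a.
  rewrite !inE; case: eqP => [E|]; last by rewrite andbF.
  by rewrite uniq_reshape_rainbow even_count_kernel E rpi ev.
move=> a; rewrite inE uniq_reshape_rainbow even_count_kernel => /andP[ra ea].
by rewrite inE preim_partitionP ra ea.
Qed.

End EvenRainbow.

End TupleKernel.

(** * Expansion of products in the group algebra *)

Section Expansion.
Variables (C : comNzRingType) (n : nat).

Definition seq_set (s : seq 'I_n) : finsets := [fset (val x).+1 | x in s]%fset.

Definition injective_sum k : galg C finsets :=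
  \sum_(a : k.-tuple 'I_n | uniq a) gelt (tuple_set a).

Lemma tuple_setE k (a : k.-tuple 'I_n) : tuple_set a = seq_set a.
Proof.
apply/fsetP => x; apply/imfsetP/imfsetP => [[i _ ->]|[y ya ->]] /=.
  by exists (tnth a i) => //; exact: mem_tnth.
by have /tnthP[i ->] := ya; exists i.
Qed.

(** Concatenation identifies pairs of tuples with longer tuples. The sum inside [gelt] is taken in
    the group [finsets]: it is an iterated symmetric difference. *)
Lemma prod_injective_sum (r : seq nat) :
  \prod_(k <- r) injective_sum k =
  \sum_(a : (sumn r).-tuple 'I_n | all uniq (reshape r a))
    gelt (\sum_(t <- reshape r a) seq_set t).
Proof.
elim: r => [|k r IH].
  rewrite big_nil (big_pred1 [tuple]) /=; first by rewrite big_nil.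
  by move=> a; apply/esym/eqP; exact: tuple0.
rewrite big_cons IH /injective_sum big_distrlr /= pair_big /=.
pose cat_pair (u : k.-tuple 'I_n * (sumn r).-tuple 'I_n) := cat_tuple u.1 u.2.
have inj : injective cat_pair.
  move=> [a b] [a' b'] /(congr1 val) /= /eqP; rewrite eqseq_cat ?size_tuple //.
  by case/andP => /eqP/val_inj -> /eqP/val_inj ->.
have bij : bijective cat_pair.
  by apply: inj_card_bij inj _; rewrite card_prod !card_tuple expnD.
rewrite [RHS](reindex cat_pair) /=; last exact: onW_bij.
have tE (a : k.-tuple 'I_n) b :
  take k (a ++ b) = a by rewrite take_size_cat ?size_tuple.
have dE (a : k.-tuple 'I_n) b :
  drop k (a ++ b) = b by rewrite drop_size_cat ?size_tuple.
apply: eq_big => [[a b]|[a b] _] /=; rewrite tE dE //.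
by rewrite big_cons tuple_setE [LHS]gmul_geltE.
Qed.

(** An integer lies in a symmetric difference when an odd number of the sets contain it; without
    repetitions in each sequence, this number is its number of occurrences. *)
Lemma seq_set_sum_eq0 (ss : seq (seq 'I_n)) : all uniq ss ->
  (\sum_(t <- ss) seq_set t == 0) =
  [forall x, ~~ odd (count_mem x (flatten ss))].
Proof.
move=> uss.
have inS x : (x.+1 \in (\sum_(t <- ss) seq_set t : finsets)) =
    odd (\sum_(t <- ss) (x.+1 \in seq_set t)).
  elim: (ss) => [|t s IH]; first by rewrite !big_nil in_fset0.
  by rewrite !big_cons in_symdiff IH oddD; case: (_ \in _).
(* Entries are shifted to start at 1, so 0 must be excluded separately. *)
have z0 : 0%N \in (\sum_(t <- ss) seq_set t : finsets) = false.
  elim: (ss) => [|t s IH]; first by rewrite !big_nil in_fset0.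
  rewrite !big_cons in_symdiff IH addbF; apply/imfsetP => -[] //.
have cE (x : 'I_n) :
    count_mem x (flatten ss) = (\sum_(t <- ss) (x.+1 \in seq_set t))%N.
  rewrite count_flatten sumnE big_map big_seq [RHS]big_seq;
    apply: eq_bigr => t /(allP uss) ut.
  rewrite count_uniq_mem //; congr nat_of_bool.
  apply/idP/imfsetP => [xt|[y yt [/val_inj->]]//]; by exists x.
have large x : (n <= x)%N -> (\sum_(t <- ss) (x.+1 \in seq_set t))%N = 0%N.
  move=> nx; apply: big1_seq => t _; case: imfsetP => // -[y _ [xy]].
  by have := ltn_ord y; rewrite ltnNge -xy nx.
apply/eqP/forallP => [s0 x|h]; first by rewrite cE -inS s0 in_fset0.
apply/fsetP => -[|x]; first by rewrite z0 in_fset0.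
rewrite inS in_fset0; have [xn|/large->//] := ltnP x n.
by apply/negbTE; have := h (Ordinal xn); rewrite cE.
Qed.

End Expansion.

Lemma gtrace_prod_injective_sum (C : comNzRingType) n (r : seq nat) :
  gtrace (\prod_(k <- r) injective_sum C n.+1 k) =
  (\sum_(pi in even_rainbow r) n.+1 ^_ #|pi|)%N%:R.
Proof.
rewrite prod_injective_sum linear_sum /= -card_even_rainbow_tuples
  -sum1dep_card.
rewrite natr_sum [RHS]big_mkcondr /=; apply: eq_bigr => a ua.
rewrite gcoef_gelt seq_set_sum_eq0 // reshapeKr ?size_tuple //.
by case: ifP.
Qed.

(** * Passage between moments and cumulants *)

Section Cumulants.
Variables (C : comNzRingType) (A : comAlgType C) (psi : A -> C) (L : nat -> A).
Implicit Types r : seq nat.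

Let moment r := psi (\prod_(k <- r) L k).
Let kappa r := cumulant psi [seq L k | k <- r].
Let subvec r m (B : {set 'I_m}) := [seq nth 0%N r i | i : 'I_m <- enum B].

Let moment_kappa r : (0 < size r)%N ->
  moment r =
  \sum_(s : {set {set 'I_(size [seq L k | k <- r])}} | partition s [set: _])
    \prod_(B in s) kappa (subvec r B).
Proof.
move=> r0; rewrite /moment -(big_map L xpredT id) moment_cumulant ?size_map //.
apply: eq_bigr => s _; apply: eq_bigr => B _; congr (cumulant psi _).
rewrite /subfamily /subvec -map_comp; apply: eq_map => i /=.
by rewrite (tnth_nth (L 0)) (nth_map 0%N) // -[X in (_ < X)%N](size_map L).
Qed.

Let natr_card_Pi2 r : all (leq 1) r ->
  #|Pi2 r|%:R =
  \sum_(s : {set {set 'I_(size [seq L k | k <- r])}} | partition s [set: _])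
    \prod_(B in s) #|Pi2star (subvec r B)|%:R :> C.
Proof.
move=> r1; rewrite (card_Pi2_partition (size_map L r) r1) natr_sum.
by apply: eq_bigr => s _; rewrite natr_prod.
Qed.

Let subvec_pos r (B : {set 'I_(size [seq L k | k <- r])}) :
  all (leq 1) r -> all (leq 1) (subvec r B).
Proof.
move=> /all_nthP r1; apply/allP => _ /mapP[i _ ->]; apply: r1.
by rewrite -[X in (_ < X)%N](size_map L).
Qed.

Let size_subvec r m (B : {set 'I_m}) : size (subvec r B) = #|B|.
Proof. by rewrite size_map -cardE. Qed.

(** Both the cumulants and the numbers of elements of [Pi2star] solve a moment-cumulant formula,
    which is triangular in the length of [r]. *)
Lemma moments_iff_cumulants :
  (forall r, (0 < size r)%N -> all (leq 1) r ->
     psi (\prod_(k <- r) L k) = #|Pi2 r|%:R) <->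
  (forall r, (0 < size r)%N -> all (leq 1) r ->
     cumulant psi [seq L k | k <- r] = #|Pi2star r|%:R).
Proof.
split=> [hM|hK] r r0 r1; last first.
  rewrite -/(moment r) moment_kappa // natr_card_Pi2 //.
  apply: eq_bigr => s /and3P[_ _ s0]; apply: eq_bigr => B Bs; apply: hK.
    by rewrite size_subvec card_gt0; apply: contraNneq s0 => <-.
  exact: subvec_pos.
have [d] := ubnP (size r); elim: d r r0 r1 => // d IH r r0 r1;
  rewrite ltnS => rd.
have := hM r r0 r1; rewrite -/(moment r) moment_kappa // natr_card_Pi2 //.
have r0' : (0 < size [seq L k | k <- r])%N by rewrite size_map.
have pT : partition [set [set: 'I_(size [seq L k | k <- r])]] [set: _].
  apply/and3P; split; rewrite ?cover1 ?trivIset1 //.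
  by rewrite in_set1 eq_sym; apply/set0Pn; exists (Ordinal r0').
(* The one-block partition carries the unknown cumulant; all other partitions have shorter blocks
   and cancel by induction. *)
rewrite (bigD1 [set [set: _]]) // [X in _ = X](bigD1 [set [set: _]]) //=.
rewrite !big_set1.
have -> : subvec r [set: 'I_(size [seq L k | k <- r])] = r.
  have sz : size (subvec r [set: 'I_(size [seq L k | k <- r])]) = size r.
    by rewrite size_subvec cardsT card_ord size_map.
  apply: (@eq_from_nth _ 0%N) => // i; rewrite sz => ir.
  have iL : (i < size [seq L k | k <- r])%N by rewrite size_map.
  rewrite /subvec enum_setT -enumT (nth_map (Ordinal iL)) ?size_enum_ord //.
  by rewrite nth_enum_ord.
have IHs (s : {set {set 'I_(size [seq L k | k <- r])}}) :
    partition s [set: _] && (s != [set [set: _]]) ->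
    \prod_(B in s) kappa (subvec r B) =
    \prod_(B in s) #|Pi2star (subvec r B)|%:R.
  case/andP => ps s1; apply: eq_bigr => B Bs.
  have /andP[B0 Br] := proper_block ps s1 Bs.
  apply: IH; rewrite ?size_subvec //; first exact: subvec_pos.
  by apply: leq_trans Br _; rewrite size_map.
by rewrite (eq_bigr _ IHs) => /addIr.
Qed.

End Cumulants.

From mathcomp Require Import -(notations) monalg.
From mathcomp Require Import -(notations) mpoly.

(** * Joint distributions evaluated on monomials *)

Section Law.
Variables (C : comNzRingType) (A : comAlgType C) (psi : {scalar A}).
Variable L : nat -> A.

(* The indeterminate of index i stands for L_(i+1). *)
Definition mnm_seq N (m : mpoly.multinom N) : seq nat :=
  flatten [seq nseq (mpoly.fun_of_multinom m i) i.+1 | i <- enum 'I_N].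

Lemma mnm_seq_pos N (m : mpoly.multinom N) : all (leq 1) (mnm_seq m).
Proof.
apply/allP => k /flattenP[_ /mapP[i _ ->]].
by rewrite mem_nseq => /andP[_ /eqP ->].
Qed.

Lemma lawE N (P : mpoly.mpoly N C) :
  law psi L P = \sum_(m <- mpoly.msupp P)
    mpoly.mcoeff m P * psi (\prod_(k <- mnm_seq m) L k).
Proof.
rewrite /law /mpoly.mmap linear_sum; apply: eq_bigr => m _.
rewrite /= mulr_algl linearZ /=; congr (_ * psi _).
rewrite big_flatten big_map big_enum; apply: eq_bigr => i _.
by rewrite big_nseq iter_mulr_1.
Qed.

(** The predecessor undoes the shift in [law]: [L k] corresponds to the indeterminate of index
    [k.-1]. *)
Definition seq_monomial N (r : seq nat) : mpoly.mpoly N.+1 C :=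
  \prod_(k <- r) mpoly.mpolyX C (mpoly.mnm1 (inord k.-1 : 'I_N.+1)).

Lemma law_seq_monomial N (r : seq nat) :
  all (fun k => 0 < k <= N.+1)%N r ->
  law psi L (seq_monomial N r) = psi (\prod_(k <- r) L k).
Proof.
move=> /allP h; rewrite /law rmorph_prod; congr (psi _).
rewrite big_seq [RHS]big_seq; apply: eq_bigr => k /h /andP[k0 kN].
by rewrite /= mpoly.mmapX mpoly.mmap1U inordK ?prednK // ltnS.
Qed.

End Law.

From mathcomp Require Import complex.
From mathcomp Require Import boolp classical_sets reals topology normedtype.
From mathcomp Require Import sequences exp.
Import numFieldNormedType.Exports.
Local Open Scope classical_set_scope.
Local Open Scope complex_scope.
Local Open Scope ring_scope.

(** * Convergence of the normalized traces and the limit law *)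

Section Limit.
Variable R : realType.

Lemma cvg_ffact_expn k :
  (n.+1 ^_ k)%:R / n.+1%:R ^+ k @[n --> \oo] --> (1 : R).
Proof.
elim: k => [|k IH].
  by under eq_fun do rewrite ffactn0 expr0 divr1; exact: cvg_cst.
have -> : (fun n => (n.+1 ^_ k.+1)%:R / n.+1%:R ^+ k.+1 : R) =
    (fun n => (n.+1 ^_ k)%:R / n.+1%:R ^+ k * (1 - k%:R * n.+1%:R^-1)).
  apply/funext => n; rewrite ffactnSr natrM exprSr invfM mulrACA;
    have [kn|nk] := leqP k n.+1.
    by rewrite natrB // mulrBl divff ?pnatr_eq0.
  (* For [n.+1 < k] the truncated subtraction differs from that of the reals, but both sides vanish
     with the falling factorial. *)
  by rewrite ffact_small // !mul0r.
have c : 1 - k%:R * n.+1%:R^-1 @[n --> \oo] --> (1 - k%:R * 0 : R).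
  by apply: cvgB; [exact: cvg_cst|apply: cvgMl_tmp; exact: cvg_harmonic].
have := cvgM IH c; rewrite mulr0 subr0 mulr1; exact.
Qed.

Lemma cvg_ffact_expn_ltn k m : (k < m)%N ->
  (n.+1 ^_ k)%:R / n.+1%:R ^+ m @[n --> \oo] --> (0 : R).
Proof.
move=> km; rewrite -(subnKC km); elim: (m - k.+1)%N => [|d IH].
  rewrite addn0; have -> : (fun n => (n.+1 ^_ k)%:R / n.+1%:R ^+ k.+1 : R) =
    (fun n => (n.+1 ^_ k)%:R / n.+1%:R ^+ k * harmonic n).
    by apply/funext => n; rewrite exprSr invfM mulrA.
  have := cvgM (cvg_ffact_expn k) cvg_harmonic; rewrite mulr0; exact.
rewrite addnS; have -> : (fun n =>
  (n.+1 ^_ k)%:R / n.+1%:R ^+ (k.+1 + d).+1 : R) =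
    (fun n => (n.+1 ^_ k)%:R / n.+1%:R ^+ (k.+1 + d) * harmonic n).
  by apply/funext => n; rewrite exprSr invfM mulrA.
have := cvgM IH cvg_harmonic; rewrite mulr0; exact.
Qed.

Lemma cvg_real_complex (u : nat -> R) (l : R) :
  u n @[n --> \oo] --> l ->
  ((u n)%:C : R[i]^o) @[n --> \oo] --> (l%:C : R[i]^o).
Proof.
move=> /cvgrPdist_lt ul; apply/cvgrPdist_lt => e e0.
(* A positive complex number is real, so it serves as a bound for the real sequence. *)
have e_real : e = (complex.Re e)%:C by rewrite RRe_real // realE ltW.
near=> n; rewrite -rmorphB normc_def /= expr0n /= addr0 sqrtr_sqr e_real ltcR.
near: n; apply: ul; by rewrite -ltcR -e_real.
Unshelve. all: by end_near. Qed.

Lemma prod_Ln n (r : seq nat) :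
  \prod_(k <- r) Ln R n.+1 k =
  ((n.+1%:R `^ (- ((sumn r)%:R / 2)))%:C) *:
    \prod_(k <- r) injective_sum R[i] n.+1 k.
Proof.
elim: r => [|k r IH]; first by rewrite !big_nil /= mul0r oppr0 powRr0 scale1r.
rewrite !big_cons IH /Ln -/(injective_sum _ _ _) -scalerAl -scalerAr scalerA.
congr (_ *: _); rewrite -rmorphM -powRD ?pnatr_eq0 ?implybT //=.
by rewrite natrD mulrDl opprD.
Qed.

(** If [sumn r] is odd then [even_rainbow r] is empty; otherwise the real exponent of the
    normalization is an integer, which allows the ordinary power. *)
Lemma gtrace_prod_Ln n (r : seq nat) :
  gtrace (\prod_(k <- r) Ln R n.+1 k) =
  (\sum_(pi in even_rainbow r) (n.+1 ^_ #|pi|)%:R / n.+1%:R ^+ (sumn r)./2)%:C.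
Proof.
rewrite prod_Ln linearZ /= gtrace_prod_injective_sum.
rewrite -(rmorph_nat (real_complex R)) -rmorphM /= natr_sum mulr_sumr;
  congr (_%:C).
apply: eq_bigr => pi /card_even_rainbow[/negbTE ro _ _]; rewrite mulrC;
  congr (_ * _).
rewrite -{1}(odd_double_half (sumn r)) ro add0n -muln2 natrM mulfK ?pnatr_eq0
  //.
by rewrite powRN powR_mulrn.
Qed.

Lemma cvg_gtrace_prod_Ln (r : seq nat) :
  (gtrace (\prod_(k <- r) Ln R n k) : R[i]^o) @[n --> \oo] -->
    (#|Pi2 r|%:R : R[i]^o).
Proof.
(* The shift drops the term [n = 0]. *)
rewrite -(cvg_shiftS _).
under eq_fun do rewrite gtrace_prod_Ln.
rewrite -(rmorph_nat (real_complex R)); apply: cvg_real_complex.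
have -> : #|Pi2 r|%:R = \sum_(pi in even_rainbow r) (pi \in Pi2 r)%:R :> R.
  rewrite -sum1_card natr_sum big_mkcond [RHS]big_mkcond;
    apply: eq_bigr => pi _.
  by case: ifP => [/Pi2_even_rainbow ->//|]; case: ifP.
apply: cvg_big => [|pi]; first exact: add_continuous.
move=> /card_even_rainbow[_ le <-].
case: eqVneq le => [-> _|ne le]; first exact: cvg_ffact_expn.
by apply: cvg_ffact_expn_ltn; rewrite ltn_neqAle ne.
Qed.

Lemma cvg_Ln_law N (P : mpoly.mpoly N R[i]) :
  Ln_law n P @[n --> \oo] -->
    (\sum_(m <- mpoly.msupp P) mpoly.mcoeff m P * #|Pi2 (mnm_seq m)|%:R :
      R[i]^o).
Proof.
rewrite /Ln_law; under eq_fun do rewrite lawE.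
apply: cvg_big => [|m _]; first exact: add_continuous.
apply: cvgMl_tmp; exact: cvg_gtrace_prod_Ln.
Qed.

Lemma has_limit_lawP (A : comAlgType R[i]) (psi : {scalar A}) (L : nat -> A) :
  psi 1 = 1 ->
  has_limit_law psi L <->
  (forall r : seq nat, (0 < size r)%N -> all (leq 1) r ->
     psi (\prod_(k <- r) L k) = #|Pi2 r|%:R).
Proof.
move=> psi1; split=> [h r r0 r1|h N P].
  (* The largest entry of [r] bounds the indeterminates needed for its monomial. *)
  have rN : all (fun k => 0 < k <= (\max_(k <- r) k).+1)%N r.
    apply/allP => k kr; rewrite (allP r1) //= leqW //.
    by rewrite (big_rem _ kr) /= leq_maxl.
  have := h _ (seq_monomial R[i] (\max_(k <- r) k) r);
    rewrite law_seq_monomial //.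
  have : Ln_law n (seq_monomial R[i] (\max_(k <- r) k) r) @[n --> \oo]
    --> (#|Pi2 r|%:R : R[i]^o).
    rewrite /Ln_law; under eq_fun do rewrite law_seq_monomial //.
    exact: cvg_gtrace_prod_Ln.
  by move=> c1 c2; apply: cvg_unique c2 c1; exact: norm_hausdorff.
rewrite (_ : law psi L P = \sum_(m <- mpoly.msupp P)
  mpoly.mcoeff m P * #|Pi2 (mnm_seq m)|%:R); first exact: cvg_Ln_law.
rewrite lawE; apply: eq_bigr => m _; congr (_ * _).
have := mnm_seq_pos m; case: (mnm_seq m) => [_|k r r1]; last exact: h.
(* The constant monomial gives the empty vector, which [h] does not cover. There the trace is
   constantly 1, so uniqueness of limits yields [#|Pi2 [::]| = 1], to be matched with
   [psi 1 = 1]. *)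
have tr1 : gtrace (1 : galg R[i] finsets) = 1 by rewrite /= gcoef_gelt eqxx.
have := @cvg_gtrace_prod_Ln [::]; under eq_fun do rewrite big_nil tr1.
rewrite big_nil psi1; apply: cvg_unique; [exact: norm_hausdorff|exact: cvg_cst].
Qed.

End Limit.

Theorem theorem4 (R : realType) :
  (forall (N : nat) (P : mpoly.mpoly N R[i]),
     cvg (Ln_law n P @[n --> \oo])) /\
  (forall (A : comAlgType R[i]) (psi : {scalar A}) (L : nat -> A),
     psi 1 = 1 ->
     (has_limit_law psi L <->
        (forall r : seq nat, (0 < size r)%N -> all (leq 1) r ->
           psi (\prod_(k <- r) L k) = #|Pi2 r|%:R)) /\
     (has_limit_law psi L <->
        (forall r : seq nat, (0 < size r)%N -> all (leq 1) r ->
           cumulant psi [seq L k | k <- r] = #|Pi2star r|%:R))).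
Proof.
split=> [N P|A psi L psi1]; first by apply/cvg_ex; eexists; exact: cvg_Ln_law.
have hM := has_limit_lawP L psi1; split=> //.
exact: iff_trans hM (moments_iff_cumulants psi L).
Qed.
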